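(* Let $\mathcal{P}_1$ be the set of odd primes $p$ such that the order $s$ of $2$ in $(\mathbb{Z}/p\mathbb{Z})^*$ equals $p-1$. The prime numbers $p\in\mathcal{P}_1$ for which $\beta>1/2$ are $3$ and $5$.
   Context: $\eta_n=(-1)^{s_2(n)}$ for $n\ge0$, where $s_2(n)$ is the sum of the binary digits of $n$. For an odd prime $p$ and $i\in\mathbb{Z}/p\mathbb{Z}$, the $p$-rarefied sum is $S_{p,i}(n)=\sum_{0\le j<n,\ j\equiv i\,(\mathrm{mod}\,p)}\eta_j$. With $s$ the order of $2$ in $(\mathbb{Z}/p\mathbb{Z})^*$, $\lambda_1$ denotes the largest modulus of an eigenvalue of the $p\times p$ matrix $M=(S_{p,i-j}(2^s))_{0\le i,j\le p-1}$ (indices $i-j$ taken mod $p$), and $\beta=\beta(p)=\frac{\log\lambda_1}{s\log2}$. *)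

(* Defs.v *)
From mathcomp Require Import all_boot all_order all_fingroup all_algebra.
From mathcomp Require Import complex.
From mathcomp Require Import classical_sets reals exp.

Set Implicit Arguments.
Unset Strict Implicit.
Unset Printing Implicit Defensive.

Import Order.TTheory GRing.Theory Num.Theory.
Local Open Scope ring_scope.

(* The digits of index i >= n vanish, since n < 2 ^ n. *)
Definition s2 (n : nat) : nat := (\sum_(i < n) n %/ 2 ^ i %% 2)%N.

Definition eta (n : nat) : int := (-1) ^+ s2 n.

(* The residue class i mod p is given by an arbitrary integer representative. *)
Definition rarefied_sum (p : nat) (i : int) (n : nat) : int :=
  \sum_(j < n | (j%:Z == i %[mod p])%Z) eta j.

(* The default value 1 of insubd is used only when 2 is not a unit of 'F_p. *)
Definition ord2 (p : nat) : nat :=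
  #[insubd (1%g : {unit 'F_p}) (2%:R : 'F_p)]%g.

Definition rarefied_mx (p : nat) : 'M[int]_p :=
  \matrix_(i < p, j < p) rarefied_sum p (i%:Z - j%:Z) (2 ^ ord2 p).

(* The set of eigenvalues is finite, and nonempty for p > 0, so that the
   supremum of their moduli is a maximum. *)
Definition lambda1 (R : realType) (p : nat) : R :=
  sup [set ComplexField.Normc.normc z | z in
        [set z : R[i] | eigenvalue (map_mx intr (rarefied_mx p)) z]]%classic.

Definition beta (R : realType) (p : nat) : R :=
  ln (lambda1 R p) / ((ord2 p)%:R * ln 2).

Definition P1 (p : nat) : Prop := [/\ prime p, odd p & ord2 p = p.-1].

(* Main.v *)
(* If 2 is a primitive root mod p then for every p-th root of unity z <> 1 the
   sum of eta_j z^j over j < 2^(p-1) is the product of the 1 - z^(2^k), k < p-1,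
   that is the product of the 1 - z^a, 0 < a < p, which is p; for z = 1 it is 0.
   Fourier inversion turns this into M = p I - J with J the all-ones matrix, so
   lambda_1 = p, and beta > 1/2 amounts to p^2 > 2^(p-1). *)
Require Import Defs.
From mathcomp Require Import all_boot all_order all_algebra.
From mathcomp Require Import reals.
From mathcomp Require Import all_fingroup cyclic algC cyclotomic.
From mathcomp Require Import ring zify.
From mathcomp Require Import complex classical_sets exp.

Set Implicit Arguments.
Unset Strict Implicit.
Unset Printing Implicit Defensive.

Import Order.TTheory GRing.Theory Num.Theory.
Local Open Scope ring_scope.

(** * Binary digit sums and the product formula for [eta] *)

(** Frees the number of summed digits, so that the sums for [n] and for [b + n.*2] can be
    aligned. *)
Lemma s2_widen n m : (n <= m)%N -> s2 n = (\sum_(i < m) n %/ 2 ^ i %% 2)%N.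
Proof.
move=> le_nm; rewrite /s2 -!(big_mkord xpredT (fun i => n %/ 2 ^ i %% 2)%N).
rewrite [RHS](big_cat_nat (n := n)) //= -[LHS]addn0; congr addn.
rewrite big_nat_cond big1 // => i /andP[/andP[le_ni _] _].
by rewrite divn_small // (leq_ltn_trans le_ni) // ltn_expl.
Qed.

Lemma s2_double_add (b : bool) n : s2 (b + n.*2) = (b + s2 n)%N.
Proof.
rewrite (@s2_widen _ (b + n.*2).+1) // big_ord_recl expn0 divn1.
have -> : ((b + n.*2) %% 2 = b)%N by case: b; lia.
congr addn; rewrite (@s2_widen n (b + n.*2)); last by lia.
apply: eq_bigr => i _; rewrite lift0 expnS divnMA.
by have -> : ((b + n.*2) %/ 2 = n)%N by case: (b); lia.
Qed.

Lemma eta_double n : eta n.*2 = eta n.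
Proof. by rewrite /eta -[n.*2]add0n (s2_double_add false). Qed.

Lemma eta_doubleS n : eta n.*2.+1 = - eta n.
Proof. by rewrite /eta -add1n (s2_double_add true) exprS mulN1r. Qed.

(** Peel off the lowest digit: the terms of index 2j and 2j+1 add up to (1 - x) [eta j] (x^2)^j,
    which leaves the induction hypothesis at x^2. *)
Lemma eta_gen (R : comNzRingType) (n : nat) (x : R) :
  \sum_(j < 2 ^ n) (eta j)%:~R * x ^+ j = \prod_(k < n) (1 - x ^+ (2 ^ k)).
Proof.
elim: n x => [|n IHn] x.
  by rewrite expn0 big_ord1 big_ord0 expr0 /eta /s2 big_ord0 mulr1.
have sum_double (F : nat -> R) m :
    \sum_(j < m.*2) F j = \sum_(j < m) (F j.*2 + F j.*2.+1).
  elim: m => [|m IHm]; first by rewrite !big_ord0.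
  by rewrite doubleS !big_ord_recr /= IHm addrA.
rewrite expnS mul2n (sum_double (fun j => (eta j)%:~R * x ^+ j)).
rewrite big_ord_recl expn0 expr1.
under [in RHS]eq_bigr => i _ do rewrite lift0 expnS exprM.
rewrite -IHn mulr_sumr; apply: eq_bigr => j _.
rewrite eta_double eta_doubleS exprS -mul2n exprM rmorphN /=.
by ring.
Qed.

Lemma rarefied_sum_mod p i n :
  rarefied_sum p (i %% p)%Z n = rarefied_sum p i n.
Proof. by rewrite /rarefied_sum; apply: eq_bigl => j; rewrite modz_mod. Qed.

(** Group the indices j by residue: x^j depends only on j mod p. *)
Lemma rarefied_sum_gen (R : comNzRingType) p n (x : R) :
  (0 < p)%N -> x ^+ p = 1 ->
  \sum_(r < p) (rarefied_sum p r n)%:~R * x ^+ r =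
  \sum_(j < n) (eta j)%:~R * x ^+ j.
Proof.
case: p => // p _ xp1.
rewrite [RHS](partition_big (fun j : 'I_n => inord (j %% p.+1) : 'I_p.+1)
  xpredT) //=.
apply: eq_bigr => r _; rewrite /rarefied_sum rmorph_sum mulr_suml /=.
have modE (j : 'I_n) :
    (inord (j %% p.+1) == r) = (j%:Z == r%:Z %[mod p.+1%:Z])%Z.
  rewrite !modz_nat (modn_small (ltn_ord r)) -val_eqE /= inordK ?ltn_mod //.
rewrite -(eq_bigl _ _ modE); apply: eq_bigr => j /eqP <-.
by rewrite inordK ?ltn_mod // expr_mod.
Qed.

(** * Odd primes, then those with 2 as a primitive root *)

Section PrimitiveRoot.
Variable p : nat.
Hypotheses (p_pr : prime p) (p_odd : odd p).

Lemma eq_pow2_mod m n :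
  (2 ^ m == 2 ^ n %[mod p])%N = (m == n %[mod ord2 p])%N.
Proof.
rewrite /ord2; set u := insubd _ _.
(* As [p] is odd, 2 is a unit, so [insubd] does not return its default. *)
have u2 : val u = 2%:R :> 'F_p.
  rewrite insubdK // unitfE -(dvdn_pcharf (pchar_Fp p_pr)).
  by rewrite dvdn_prime2 //; apply: contraTneq p_odd => ->.
rewrite -eq_expg_mod_order -val_eqE /= !FinRing.val_unitX /= u2 -!natrX.
by rewrite -val_eqE /= !val_Fp_nat.
Qed.

Lemma ord2_dvd n : (ord2 p %| n)%N = (2 ^ n == 1 %[mod p])%N.
Proof. by rewrite -(expn0 2) eq_pow2_mod mod0n. Qed.

Lemma ord2_gt0 : (0 < ord2 p)%N.
Proof. exact: order_gt0. Qed.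

Hypothesis ord2_p : ord2 p = p.-1.

(** These p - 1 residues are distinct by the order of 2 and nonzero because p is odd, so they
    exhaust 1, ..., p - 1. *)
Lemma perm_pow2_mod :
  perm_eq [seq 2 ^ k %% p | k <- iota 0 p.-1]%N (iota 1 p.-1).
Proof.
have p_gt0 := prime_gt0 p_pr.
have inj : {in iota 0 p.-1 &, injective (fun k => 2 ^ k %% p)%N}.
  move=> i j; rewrite !mem_iota /= !add0n => lt_i lt_j /eqP.
  by rewrite eq_pow2_mod ord2_p !modn_small // => /eqP.
have U : uniq [seq 2 ^ k %% p | k <- iota 0 p.-1]%N.
  by rewrite map_inj_in_uniq // iota_uniq.
apply: uniq_perm => //; first exact: iota_uniq.
apply: (uniq_min_size U _ _).2; last by rewrite size_map !size_iota.
move=> _ /mapP[k _ ->]; rewrite mem_iota add1n prednK // ltn_mod p_gt0 andbT.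
rewrite lt0n -/(_ %| _)%N Euclid_dvdX // dvdn_prime2 //.
by case: eqP p_odd => // ->.
Qed.

(** Cancel X - 1 in the factorization of X^p - 1, then evaluate 1 + X + ... + X^(p-1) at 1. *)
Lemma prod_primitive_root (F : fieldType) (z : F) :
  p.-primitive_root z -> \prod_(1 <= i < p) (1 - z ^+ i) = p%:R.
Proof.
move=> z_pr; have /eqP := factor_Xn_sub_1 z_pr.
rewrite big_ltn ?prime_gt0 // expr0 subrX1 (inj_eq (mulfI _)) ?polyXsubC_eq0 //.
move=> /eqP/(congr1 (horner^~ 1)).
rewrite horner_prod horner_sum.
under eq_bigr do rewrite hornerXsubC.
move=> ->; under eq_bigr do rewrite hornerXn expr1n.
by rewrite sumr_const card_ord.
Qed.

Lemma prod_pow2_primitive_root (F : fieldType) (z : F) :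
  p.-primitive_root z -> \prod_(k < p.-1) (1 - z ^+ (2 ^ k)) = p%:R.
Proof.
move=> z_pr; rewrite -(prod_primitive_root z_pr).
rewrite /index_iota subn1 -(perm_big _ perm_pow2_mod) big_map /=.
rewrite -(big_mkord xpredT (fun k => 1 - z ^+ (2 ^ k))).
rewrite /index_iota !subn0.
by apply: eq_bigr => k _; rewrite prim_expr_mod.
Qed.

(** Fourier inversion in polynomial form: the differences [c r] of the two sides are the
    coefficients of a polynomial of size at most p that vanishes at all p of the p-th roots of
    unity. *)
Lemma rarefied_sum_primitive (r : nat) : (r < p)%N ->
  rarefied_sum p r (2 ^ p.-1) = p%:R *+ (r == 0%N) - 1.
Proof.
have p_gt0 := prime_gt0 p_pr.
have [z z_pr] := C_prim_root_exists p_gt0.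
pose c r := rarefied_sum p r%:Z (2 ^ p.-1) - (p%:R *+ (r == 0%N) - 1).
pose P : {poly algC} := \poly_(r < p) (c r)%:~R.
suff P0 : P = 0.
  move=> lt_rp; apply/eqP; rewrite -subr_eq0 -/(c r) -(intr_eq0 algC).
  by have := coef0 algC r; rewrite -P0 coef_poly lt_rp => ->.
apply: (roots_geq_poly_eq0 (rs := [seq z ^+ i | i <- iota 0 p])); last first.
- by rewrite size_map size_iota size_poly.
- rewrite map_inj_in_uniq ?iota_uniq // => i j; rewrite !mem_iota !add0n /=.
  move=> lt_i lt_j /eqP; rewrite (eq_prim_root_expr z_pr) !modn_small //.
  by move/eqP.
apply/allP => _ /mapP[i lt_ip ->].
move: lt_ip; rewrite mem_iota add0n /= => lt_ip.
set x := z ^+ i.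
have xp1 : x ^+ p = 1 by rewrite /x exprAC (prim_expr_order z_pr) expr1n.
rewrite /root horner_poly.
under eq_bigr => k _ do rewrite /c rmorphB /= mulrBl.
rewrite sumrB rarefied_sum_gen // eta_gen subr_eq0.
(* The claimed values sum to p - (1 + x + ... + x^(p-1)). *)
under [X in _ == X]eq_bigr => k _ do
  rewrite rmorphB /= rmorphMn /= mulrBl mul1r mulrnAl.
rewrite sumrB (bigD1 (Ordinal p_gt0)) //= [X in _ + X - _]big1 ?addr0; last first.
  by move=> k; rewrite -val_eqE /= => /negPf ->.
rewrite expr0 mulr1 mulr1n.
(* At x = 1 the factor k = 0 kills the product, and the other side is p - p. *)
have [i0|i_gt0] := posnP i.
  have -> : x = 1 by rewrite /x i0 expr0.
  have p1_gt0 : (0 < p.-1)%N by rewrite -ord2_p ord2_gt0.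
  rewrite (bigD1 (Ordinal p1_gt0)) //= expr1 subrr mul0r.
  under [X in _ - X]eq_bigr => k _ do rewrite expr1n.
  by rewrite sumr_const card_ord rmorph_nat subrr.
have x_neq1 : x != 1.
  rewrite /x -(prim_order_dvd z_pr); apply: contraTN lt_ip => dvd_pi.
  by rewrite -leqNgt dvdn_leq.
have x_pr : p.-primitive_root x.
  by rewrite /x prim_root_exp_coprime // coprime_sym prime_coprime // gtnNdvd.
have -> : \sum_(j < p) x ^+ j = 0.
  apply: (mulfI (x := x - 1)); first by rewrite subr_eq0.
  by rewrite -subrX1 xp1 subrr mulr0.
by rewrite rmorph_nat subr0 prod_pow2_primitive_root.
Qed.

(** For indices below p, i - j is 0 mod p exactly on the diagonal. *)
Lemma rarefied_mxE (R : nzRingType) :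
  map_mx intr (rarefied_mx p) = p%:R%:M - const_mx 1 :> 'M[R]_p.
Proof.
apply/matrixP => i j; rewrite !mxE ord2_p -rarefied_sum_mod.
have p_gt0 := prime_gt0 p_pr.
set r := ((_ - _) %% _)%Z.
have r_ge0 : 0 <= r by rewrite modz_ge0 //; lia.
have r_lt : r < p%:Z by rewrite ltz_pmod //; lia.
have -> : r = `|r|%N by lia.
rewrite rarefied_sum_primitive; last by lia.
rewrite rmorphB /= rmorphMn /= rmorph_nat; congr (_ *+ _ - _).
rewrite absz_eq0 /r (sameP eqP dvdz_mod0P) -eqz_mod_dvd !modz_small //.
  by rewrite ltz_nat ltn_ord.
by rewrite ltz_nat ltn_ord.
Qed.

(** From J^2 = pJ follows A^2 = pA, so every eigenvalue is 0 or p; no characteristic polynomial is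
    computed. *)
Lemma lambda1_primitive (R : realType) : lambda1 R p = p%:R.
Proof.
have p_gt1 := prime_gt1 p_pr.
rewrite /lambda1 rarefied_mxE.
set A := _%:M - _; set E := (X in sup X).
pose J : 'M[R[i]]_p := const_mx 1.
have J2 : J *m J = p%:R *: J.
  apply/matrixP => i j; rewrite !mxE.
  under eq_bigr => k _ do rewrite !mxE mulr1.
  by rewrite sumr_const card_ord mulr1.
have AA : A *m A = p%:R *: A.
  rewrite /A -/J mulmxBl !mulmxBr J2 -!scalar_mxM !mul_scalar_mx !mul_mx_scalar.
  by rewrite subrr subr0 scalerBr scale_scalar_mx.
have normcp : ComplexField.Normc.normc (p%:R : R[i]) = p%:R.
  rewrite -(rmorph_nat (real_complex R)) /= expr0n addr0 sqrtr_sqr.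
  by rewrite ger0_norm.
have ubE : ubound E p%:R.
  move=> _ [z /eigenvalueP[v vA v0] <-].
  have /eqP : z *: (z *: v) = p%:R *: (z *: v).
    by rewrite -vA scalemxAl -vA -mulmxA AA scalemxAr.
  rewrite -subr_eq0 -scalerBl !scaler_eq0 (negPf v0) orbF subr_eq0.
  case/orP => /eqP ->; rewrite ?normcp //.
  by rewrite ComplexField.Normc.normc0 ler0n.
have Ep : E p%:R.
  exists p%:R => //; apply/eigenvalueP.
  (* The difference of two basis vectors is killed by J, hence is an eigenvector for p. *)
  pose i0 := Ordinal (ltnW p_gt1); pose i1 := Ordinal p_gt1.
  exists (delta_mx 0 i0 - delta_mx 0 i1); last first.
    apply/eqP => /rowP/(_ i0)/eqP.
    by rewrite !mxE !eqxx subr0 oner_eq0.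
  rewrite mulmxBr mul_mx_scalar mulmxBl -!rowE.
  by rewrite !row_const subrr subr0.
apply/eqP; rewrite eq_le; apply/andP; split; first by apply: ge_sup => //; exists p%:R.
by apply: sup_upper_bound => //; split; exists p%:R.
Qed.

(** Take logarithms: both sides say (p - 1) ln 2 < 2 ln p. *)
Lemma beta_primitive (R : realType) :
  (1 / 2 < beta R p) = (2 ^ p.-1 < p ^ 2)%N.
Proof.
have p_gt1 := prime_gt1 p_pr.
have ln2 : 0 < ln 2 :> R by rewrite ln_gt0 // ltr1n.
rewrite /beta lambda1_primitive ord2_p ltr_pdivlMr; last first.
  by rewrite mulr_gt0 // ltr0n -ord2_p ord2_gt0.
rewrite -(ltr_nat R) !natrX -[RHS]ltr_ln ?posrE ?exprn_gt0 ?ltr0n ?prime_gt0 //.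
rewrite !lnXn ?ltr0n ?prime_gt0 // -mulr_natl -[X in _ = (_ < X)]mulr_natl.
by rewrite -[RHS](ltr_pM2l (x := 1 / 2)) ?divr_gt0 // !mulrA; congr (_ < _); field.
Qed.

End PrimitiveRoot.

(** The bound 6 is sharp: 49 <= 64, but 36 > 32. It corresponds to p = 7 under n = p - 1. *)
Lemma sqr_leq_pow2 n : (6 <= n)%N -> (n.+1 ^ 2 <= 2 ^ n)%N.
Proof.
elim: n => // n IHn; rewrite leq_eqVlt => /orP[/eqP <- //|n6].
have := IHn n6; rewrite [(2 ^ n.+1)%N]expnS; nia.
Qed.

Lemma P1_3 : P1 3.
Proof.
split=> //; have ord_dvd := @ord2_dvd 3 isT isT.
have /dvdn_leq : (ord2 3 %| 2)%N by rewrite ord_dvd.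
have : ~~ (ord2 3 %| 1)%N by rewrite ord_dvd.
by have := ord2_gt0 3; case: (ord2 3) => [|[|[|n]]] // _ _ /(_ isT).
Qed.

(** The order divides 4 but not 2, which excludes 1, 2 and 3. *)
Lemma P1_5 : P1 5.
Proof.
split=> //; have ord_dvd := @ord2_dvd 5 isT isT.
have /dvdn_leq : (ord2 5 %| 4)%N by rewrite ord_dvd.
have : ~~ (ord2 5 %| 2)%N by rewrite ord_dvd.
have : (ord2 5 %| 4)%N by rewrite ord_dvd.
by have := ord2_gt0 5; case: (ord2 5) => [|[|[|[|[|n]]]]] // _ _ _ /(_ isT).
Qed.

Theorem proposition5p5 (R : realType) (p : nat) :
  P1 p /\ 1 / 2 < beta R p <-> p = 3%N \/ p = 5%N.
Proof.
split=> [[[p_pr p_odd ord2_p]]|].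
  rewrite beta_primitive //; case: (ltnP p 7) => [|p7].
    (* Below 7 the only odd primes are 3 and 5. *)
    by case: p p_pr p_odd {ord2_p} => [|[|[|[|[|[|[|p]]]]]]] //; auto.
  have : (p ^ 2 <= 2 ^ p.-1)%N.
    by rewrite -{1}[p](prednK (prime_gt0 p_pr)) sqr_leq_pow2 //; lia.
  by rewrite leqNgt => /negPf ->.
have [[p3 o3 s3] [p5 o5 s5]] := (P1_3, P1_5).
(* What remains is 4 < 9 and 16 < 25. *)
by case=> ->; split; rewrite ?beta_primitive.
Qed.
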